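(* Let $\rho_h^n\in\mathbb V_h$ have positive nodal values $\rho_i^n$, let $r_h\in\mathbb V_h$ be positive, let $\boldsymbol v_h^n,\boldsymbol v_h^k\in\mathbb V_h^3$ and $\boldsymbol H_h^n,\boldsymbol H_h^k\in\mathbb H_{h,0}$, let $\tau>0$, and let $j$ be the Jacobian bilinear form defined in the context. Assume that $$\|\mathrm{curl}\boldsymbol H_h^n\|_{L^\infty(\Omega)}\le c_h,\qquad\|\mathrm{curl}\boldsymbol H_h^k\|_{L^\infty(\Omega)}\le c_h,$$ $$\big\|\tfrac{d_i}{\rho_h^n}\mathrm{curl}\boldsymbol H_h^n-\boldsymbol v_h^n\big\|_{L^\infty(\Omega)}\le c_e,\qquad\big\|\tfrac{d_i}{\rho_h^n}\mathrm{curl}\boldsymbol H_h^k-\boldsymbol v_h^k\big\|_{L^\infty(\Omega)}\le c_e,$$ for some positive bounded constants $c_h<+\infty$ and $c_e<+\infty$. Then for all $[\delta\boldsymbol v,\delta\boldsymbol H]\in\mathbb V_h^3\times\mathbb H_{h,0}$ the following coercivity estimate holds: $$\begin{aligned} j([\delta\boldsymbol v,\delta\boldsymbol H],[\delta\boldsymbol v,\delta\boldsymbol H])\ \ge\ &\big(c_m^2\rho_{\min}^n-\tfrac14\tau\mu c_h\big)\|\delta\boldsymbol v\|_{L^2(\Omega)}^2+\mu\big(1-\tfrac14(c_h\tau+c_e\tau^{1/2})\big)\|\delta\boldsymbol H\|_{L^2(\Omega)}^2\\ &+\tfrac12\tau\big(r_{\min}-\tfrac12\mu c_e\tau^{1/2}\big)\|\mathrm{curl}\,\delta\boldsymbol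 H\|_{L^2(\Omega)}^2, \end{aligned}$$ where $\rho_{\min}^n=\min_{i\in\mathcal V}\rho_i^n$ and $r_{\min}=\min_{\boldsymbol x}r_h(\boldsymbol x)$.
   Context: Finite element spaces. $\Omega\subset\mathbb R^d$ ($d=2$ or $3$) is a bounded domain with outward unit normal $\boldsymbol n$ and a conforming simplicial mesh $\mathcal T_h$; $T_K:\widehat K\to K$ is a diffeomorphism from the unit simplex $\widehat K$ to $K\in\mathcal T_h$, and $\mathbb P^1(\widehat K)$ denotes polynomials of degree at most $1$. Define - $\mathbb V_h=\{v_h\in C^0(\Omega): v_h\circ T_K\in\mathbb P^1(\widehat K)\ \forall K\}$, with nodal basis $\{\phi_i\}_{i\in\mathcal V}$ ($\phi_i(\boldsymbol x_j)=\delta_{ij}$, $\sum_i\phi_i=1$), and lumped masses $m_i=\int_\Omega\phi_i\,d\boldsymbol x$; - $\mathbb H_h=\{\boldsymbol\xi_h\in H(\mathrm{curl},\Omega):[\nabla T_K]^{\top}(\boldsymbol\xi_h\circ T_K)\in[\mathbb P^1(\widehat K)]^d\ \forall K\}$ and $\mathbb H_{h,0}=\{\boldsymbol\xi_h\in\mathbb H_h:\boldsymbol\xi_h\times\boldsymbol n=\boldsymbol0\text{ on }\partial\Omega\}$. Convention for $d=2$: all vector fields have three components and are independent of the out-of-plane coordinate $z$ ($\partial_z\equiv 0$). The space $\mathbb H_h$ is replaced by fields whose in-plane part is in the two-dimensional space $\mathbb H_h$ above and whose $z$-component is in $\mathbb V_h$; $\mathbb H_{h,0}$ is its subspace with $\boldsymbol\xi_h\times\boldsymbol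 n=\boldsymbol0$ on $\partial\Omega$ where $\boldsymbol n=(n_x,n_y,0)$; and $\mathrm{curl}\boldsymbol H=(\partial_yH_z,-\partial_xH_z,\partial_xH_y-\partial_yH_x)$. Lumped products: $\langle\boldsymbol v_h,\boldsymbol w_h\rangle=\sum_{i\in\mathcal V}m_i\boldsymbol v_i\cdot\boldsymbol w_i$ and $\langle\rho_h\boldsymbol v_h,\boldsymbol w_h\rangle=\sum_{i\in\mathcal V}m_i\rho_i\,\boldsymbol v_i\cdot\boldsymbol w_i$. The constant $c_m>0$ is (together with $c_M$) a constant in the norm equivalence $c_m\|\boldsymbol v_h\|_{L^2(\Omega)}\le\langle\boldsymbol v_h,\boldsymbol v_h\rangle^{1/2}\le c_M\|\boldsymbol v_h\|_{L^2(\Omega)}$ for all $\boldsymbol v_h\in\mathbb V_h^3$. The constants $\mu>0$ and $d_i>0$ are given, and $(\cdot,\cdot)$ below denotes the $L^2(\Omega)$ inner product. Jacobian. $j$ is the Jacobian, at the Newton iterate $[\boldsymbol v_h^k,\boldsymbol H_h^k]$, of the Crank–Nicolson discretization (time-step $\tau$, previous state $[\boldsymbol v_h^n,\boldsymbol H_h^n]$) of the coupled Lorentz-force/resistive-Hall induction system. Explicitly, for $[\delta\boldsymbol v,\delta\boldsymbol H],[\boldsymbol w,\boldsymbol\xi]\in\mathbb V_h^3\times\mathbb H_{h,0}$, $$\begin{aligned} j([\delta\boldsymbol v,\delta\boldsymbol H],[\boldsymbol w,\boldsymbol\xi])=\ &\langle\rho_h^n\delta\boldsymbol v,\boldsymbol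 w\rangle+\mu(\delta\boldsymbol H,\boldsymbol\xi)\\ &-\tfrac14\tau\mu(\mathrm{curl}\,\delta\boldsymbol H\times\boldsymbol H_h^n,\boldsymbol w)-\tfrac14\tau\mu(\mathrm{curl}\boldsymbol H_h^k\times\delta\boldsymbol H,\boldsymbol w)\\ &-\tfrac14\tau\mu(\mathrm{curl}\,\delta\boldsymbol H\times\boldsymbol H_h^k,\boldsymbol w)-\tfrac14\tau\mu(\mathrm{curl}\boldsymbol H_h^n\times\delta\boldsymbol H,\boldsymbol w)\\ &+\tfrac14\tau\mu(\mathrm{curl}\boldsymbol\xi\times\boldsymbol H_h^n,\delta\boldsymbol v)+\tfrac14\tau\mu(\mathrm{curl}\boldsymbol\xi\times\delta\boldsymbol H,\boldsymbol v_h^n)\\ &+\tfrac14\tau\mu(\mathrm{curl}\boldsymbol\xi\times\boldsymbol H_h^k,\delta\boldsymbol v)+\tfrac14\tau\mu(\mathrm{curl}\boldsymbol\xi\times\delta\boldsymbol H,\boldsymbol v_h^k)\\ &+\tfrac12\tau(r_h\,\mathrm{curl}\,\delta\boldsymbol H,\mathrm{curl}\boldsymbol\xi)+\tfrac14\mu d_i\tau\big(\tfrac1{\rho_h^n}\mathrm{curl}\boldsymbol H_h^n\times\delta\boldsymbol H,\mathrm{curl}\boldsymbol\xi\big)\\ &+\tfrac14\mu d_i\tau\big(\tfrac1{\rho_h^n}\mathrm{curl}\,\delta\boldsymbol H\times\boldsymbol H_h^n,\mathrm{curl}\boldsymbol\xi\big)+\tfrac14\mu d_i\tau\big(\tfrac1{\rho_h^n}\mathrm{curl}\boldsymbol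 H_h^k\times\delta\boldsymbol H,\mathrm{curl}\boldsymbol\xi\big)\\ &+\tfrac14\mu d_i\tau\big(\tfrac1{\rho_h^n}\mathrm{curl}\,\delta\boldsymbol H\times\boldsymbol H_h^k,\mathrm{curl}\boldsymbol\xi\big). \end{aligned}$$ *)

(* Defs.v *)
From HB Require Import structures.
From mathcomp Require Import all_boot all_order all_algebra.
From mathcomp Require Import all_classical all_reals all_analysis.

Set Implicit Arguments.
Unset Strict Implicit.
Unset Printing Implicit Defensive.

Import Order.TTheory GRing.Theory Num.Theory.
Import numFieldNormedType.Exports.

Local Open Scope classical_set_scope.
Local Open Scope ring_scope.

(* Lebesgue measure on R^n = 'rV[R]_n, with the sigma-algebra generated by the
   coordinates (the Borel one), built as the iterated product of the
   one-dimensional Lebesgue measure; [lebesgue_rV_box] computes it on boxes. *)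
Definition rV_display : measure_display. Proof. exact: default_measure_display. Qed.

Section measurable_rV.
Context {R : realType} (n : nat).

Let coord : 'I_n -> 'rV[R]_n -> R := fun i x => x ord0 i.

Let rV_set0 : g_sigma_preimage coord set0.
Proof. exact: sigma_algebra0. Qed.

Let rV_setC A : g_sigma_preimage coord A -> g_sigma_preimage coord (~` A).
Proof. exact: sigma_algebraC. Qed.

Let rV_bigcup (F : (set 'rV[R]_n)^nat) : (forall i, g_sigma_preimage coord (F i)) ->
  g_sigma_preimage coord (\bigcup_i (F i)).
Proof. exact: sigma_algebra_bigcup. Qed.

HB.instance Definition _ := @isMeasurable.Build rV_display
  'rV[R]_n (g_sigma_preimage coord) rV_set0 rV_setC rV_bigcup.

End measurable_rV.


Lemma measurable_rVP {R : realType} d (T : measurableType d) n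
    (f : T -> 'rV[R]_n) :
  (forall i, measurable_fun [set: T] (fun x => f x ord0 i)) ->
  measurable_fun [set: T] f.
Proof.
move=> mf _ Y; rewrite setTI.
suff : g_sigma_preimage (fun i x => f x ord0 i) `<=` measurable.
  move=> H mY; apply: H.
  by rewrite (g_sigma_preimage_comp (fun i (x : 'rV[R]_n) => x ord0 i) f);
    exists Y => //; rewrite setTI.
apply: smallest_sub; first exact: sigma_algebra_measurable.
case: n f mf Y => [|n] f mf Y; first by rewrite big_ord0.
rewrite -bigcup_mkord_ord; apply: bigcup_sub => i Ii.
by move=> A [B mB <-]; exact: mf.
Qed.

Lemma measurable_coord {R : realType} n (i : 'I_n) :
  measurable_fun [set: 'rV[R]_n] (fun x => x ord0 i).
Proof.
move=> _ Y mY; rewrite setTI; apply: sub_sigma_algebra => /=.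
rewrite -bigcup_seq/=; exists i => /=; first by rewrite mem_index_enum.
by exists Y => //; rewrite setTI.
Qed.

Definition row_cons {R : realType} n (p : 'rV[R]_n * R) : 'rV[R]_n.+1 :=
  \row_i oapp (fun j => p.1 ord0 j) p.2 (unlift ord0 i).

Lemma measurable_row_cons {R : realType} n :
  measurable_fun [set: 'rV[R]_n * R] (@row_cons R n).
Proof.
apply: measurable_rVP => i.
case: (unliftP ord0 i) => [j ->|->].
- under eq_fun do rewrite mxE liftK /=.
  exact: (measurableT_comp (measurable_coord j) measurable_fst).
- under eq_fun do rewrite mxE unlift_none /=; exact: measurable_snd.
Qed.

(* The canonical structure is named because inference does not find the
   measurability proof of the map. *)
Fixpoint lebesgue_rV (R : realType) n : {measure set 'rV[R]_n -> \bar R} :=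
  match n with
  | 0 => dirac (0 : 'rV[R]_0)
  | k.+1 => measure_function_pushforward__canonical__measure_function_Measure
     ((lebesgue_rV R k \x (@lebesgue_measure R))%E) (measurable_row_cons (n := k))
  end.

Lemma lebesgue_rVS (R : realType) n (A : set 'rV[R]_n.+1) :
  lebesgue_rV R n.+1 A =
  (lebesgue_rV R n \x @lebesgue_measure R)%E (@row_cons R n @^-1` A).
Proof. by []. Qed.

Lemma lebesgue_rV_box (R : realType) n (a b : 'rV[R]_n) :
  (forall i, a ord0 i <= b ord0 i) ->
  lebesgue_rV R n [set x | forall i, a ord0 i <= x ord0 i <= b ord0 i]
  = (\prod_(i < n) (b ord0 i - a ord0 i))%:E.
Proof.
elim: n a b => [|n IH] a b ab.
  by rewrite big_ord0 /= diracE mem_set//= => -[].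
pose a' : 'rV[R]_n := \row_i a ord0 (lift ord0 i).
pose b' : 'rV[R]_n := \row_i b ord0 (lift ord0 i).
rewrite big_ord_recl lebesgue_rVS.
rewrite (_ : @row_cons R n @^-1` _ = [set x : 'rV[R]_n | forall i, a' ord0 i <= x ord0 i <= b' ord0 i]
   `*` `[a ord0 ord0, b ord0 ord0]); last first.
  apply/seteqP; split => -[x t] /=.
    move=> H; split => [i|].
      by have := H (lift ord0 i); rewrite !mxE liftK.
    by have := H ord0; rewrite !mxE unlift_none /= in_itv.
  move=> [H1 H2] i; rewrite mxE; case: unliftP => [j ->|->] /=.
    by have := H1 j; rewrite !mxE.
  by rewrite in_itv in H2.
rewrite product_measure1E//=.
  rewrite IH; last by move=> i; rewrite !mxE.
  rewrite lebesgue_measure_itv/= lte_fin.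
  have -> : (if (a ord0 ord0 < b ord0 ord0)%R then
      ((b ord0 ord0)%:E - (a ord0 ord0)%:E)%E else 0%E) =
      (b ord0 ord0 - a ord0 ord0)%:E.
    case: ltP => [//|h]; congr (_%:E); apply/esym/eqP; rewrite subr_eq0.
    by rewrite eq_le h ab.
  rewrite -EFinM mulrC; congr ((_ * _)%:E); apply: eq_bigr => i _.
  by rewrite !mxE.
rewrite (_ : [set x | _] = \bigcap_(i in [set: 'I_n])
   ((fun x : 'rV_n => x ord0 i) @^-1` `[a' ord0 i, b' ord0 i])).
  apply: fin_bigcap_measurable => [|i _]; first exact: finite_finset.
  rewrite -[X in measurable X]setTI.
  exact: (measurable_coord i measurableT (measurable_itv _)).
apply/seteqP; split => x /= H i; first by move=> _; rewrite /= in_itv; exact: H.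
by have := H i I; rewrite /= in_itv.
Qed.

Section vectors.
Context {R : realType}.

Definition dot n (u v : 'rV[R]_n) : R := \sum_(i < n) u 0 i * v 0 i.

Definition enorm n (u : 'rV[R]_n) : R := Num.sqrt (dot u u).

Definition row3 (a b c : R) : 'rV[R]_3 := \row_(i < 3) [:: a; b; c]`_i.

Definition cross (u v : 'rV[R]_3) : 'rV[R]_3 :=
  row3 (u 0 1 * v 0 2%:R - u 0 2%:R * v 0 1)
       (u 0 2%:R * v 0 0 - u 0 0 * v 0 2%:R)
       (u 0 0 * v 0 1 - u 0 1 * v 0 0).

Context {d : nat}.

(* For d = 2 or 3: the first d components of a three-component vector, and the
   extension of a vector of R^d by zero components. *)
Definition inplane (u : 'rV[R]_3) : 'rV[R]_d := \row_(k < d) u 0 (inord k).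

Definition embed (u : 'rV[R]_d) : 'rV[R]_3 :=
  \row_(i < 3) oapp (fun k : 'I_d => u 0 k) 0 (insub (val i)).

End vectors.

Section calculus.
Context {R : realType} {d : nat}.
Implicit Types (f : 'rV[R]_d -> R) (xi om : 'rV[R]_d -> 'rV[R]_3).
Implicit Types (Om : set 'rV[R]_d).

(* For j >= d the direction is the zero vector, so that the derivative is zero:
   fields on a two-dimensional domain do not depend on z. *)
Definition partial (j : nat) f (x : 'rV[R]_d) : R :=
  'D_(\row_(k < d) (val k == j)%:R) f x.

Definition pcurl xi (x : 'rV[R]_d) : 'rV[R]_3 :=
  let D j i := partial j (fun y => xi y 0 i) x in
  row3 (D 1%N 2%:R - D 2%N 1) (D 2%N 0 - D 0%N 2%:R) (D 0%N 1 - D 1%N 0).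

Fixpoint Cn (n : nat) f : Prop :=
  match n with
  | 0 => continuous f
  | m.+1 => (forall x, differentiable f x) /\ (forall v, Cn m ('D_v f))
  end.

Definition test_field Om xi : Prop :=
  [/\ forall n i, Cn n (fun x => xi x 0 i),
      compact (closure [set x | xi x != 0]) &
      closure [set x | xi x != 0] `<=` Om].

Definition L2 Om xi : Prop :=
  forall i, (fun x => xi x 0 i) \_ Om \in Lfun (lebesgue_rV R d) 2%:E.

Definition ip Om xi om : R :=
  \int[lebesgue_rV R d]_(x in Om) dot (xi x) (om x).

Definition L2norm Om xi : R := Num.sqrt (ip Om xi xi).

Definition Linfnorm Om xi : \bar R :=
  'N[lebesgue_rV R d]_+oo [EFin \o ((fun x => enorm (xi x)) \_ Om)]%E.

Definition weak_curl Om xi om : Prop :=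
  L2 Om om /\ forall psi, test_field Om psi -> ip Om om psi = ip Om xi (pcurl psi).

Definition Hcurl Om xi : Prop := L2 Om xi /\ exists om, weak_curl Om xi om.

(* A representative of the weak curl (unique up to a null set); the default
   value 0 only concerns fields that have no weak curl in L^2. *)
Definition curl Om xi : 'rV[R]_d -> 'rV[R]_3 :=
  xget (fun=> 0) [set om | weak_curl Om xi om].

(* C^1 diffeomorphism between A and its image, in the usual sense for sets that
   need not be open: T and its inverse extend to C^1 maps on neighbourhoods. *)
Definition C1_on (U : set 'rV[R]_d) (T : 'rV[R]_d -> 'rV[R]_d) : Prop :=
  forall x, U x -> differentiable T x /\ {for x, continuous (fun y => 'J T y)}.

Definition diffeo_on (A : set 'rV[R]_d) (T : 'rV[R]_d -> 'rV[R]_d) : Prop :=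
  exists (U W : set 'rV[R]_d) (S : 'rV[R]_d -> 'rV[R]_d),
    [/\ open U /\ A `<=` U, open W /\ T @` A `<=` W, C1_on U T, C1_on W S &
        forall x, A x -> S (T x) = x].

Definition bounded_domain Om : Prop :=
  [/\ open Om, connected Om, bounded_set Om & Om !=set0].

Definition frontier Om : set 'rV[R]_d := closure Om `\` Om°.

(* nu is the outward unit normal of Om at x: to first order at x, Om is the
   half-space opposite to nu. *)
Definition outward_normal_at Om (x nu : 'rV[R]_d) : Prop :=
  dot nu nu = 1 /\
  forall e : R, 0 < e -> \forall y \near x,
    (dot (y - x) nu < - (e * enorm (y - x)) -> Om y) /\
    (e * enorm (y - x) < dot (y - x) nu -> ~ Om y).

(* Barycentric coordinates, vertices, faces (spanned by a set of vertices) and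
   facets of the unit simplex; the vertex ord0 is the origin. *)
Definition bary (i : 'I_d.+1) (x : 'rV[R]_d) : R :=
  oapp (fun k => x 0 k) (1 - \sum_k x 0 k) (unlift ord0 i).

Definition Khat : set 'rV[R]_d := [set x | forall i, 0 <= bary i x].

Definition vtx (i : 'I_d.+1) : 'rV[R]_d := \row_(k < d) (i == lift ord0 k)%:R.

Definition face (s : {set 'I_d.+1}) : set 'rV[R]_d :=
  [set x | Khat x /\ forall i, i \notin s -> bary i x = 0].

Definition facet (i : 'I_d.+1) : set 'rV[R]_d :=
  [set x | Khat x /\ bary i x = 0].

Definition facet_relint (i : 'I_d.+1) : set 'rV[R]_d :=
  [set x | bary i x = 0 /\ forall j, j != i -> 0 < bary j x].

Definition P1_on (A : set 'rV[R]_d) f : Prop :=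
  exists (a : R) (b : 'rV[R]_d), forall x, A x -> f x = a + dot b x.

End calculus.

Section finite_elements.
Context {R : realType} {d : nat} (Om : set 'rV[R]_d) {E V : finType}.
(* E indexes the elements K = T_K(Khat), V the vertices x_i = X i. *)
Variables (T : E -> 'rV[R]_d -> 'rV[R]_d) (X : V -> 'rV[R]_d).

(* Conformity: two distinct elements meet in the image of a common proper face
   (possibly the empty one, s = set0). *)
Definition simplicial_mesh : Prop :=
  [/\ forall K, diffeo_on Khat (T K),
      \bigcup_(K in [set: E]) (T K @` Khat) = closure Om,
      forall K K', K != K' -> exists s s' : {set 'I_d.+1},
        [/\ (#|s| <= d)%N, (#|s'| <= d)%N,
            (T K @` Khat) `&` (T K' @` Khat) = T K @` face s &
            T K @` face s = T K' @` face s'],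
      injective X &
      range X = [set x | exists K i, x = T K (vtx i)]].

Definition boundary_facet (K : E) (i : 'I_d.+1) : Prop :=
  T K @` facet i `<=` frontier Om.

Definition outward_unit_normal (n : 'rV[R]_d -> 'rV[R]_d) : Prop :=
  forall K i x, boundary_facet K i -> facet_relint i x ->
    outward_normal_at Om (T K x) (n (T K x)).

Definition in_Vh (v : 'rV[R]_d -> R) : Prop :=
  {within closure Om, continuous v} /\ forall K, P1_on Khat (v \o T K).

Definition in_Vh3 (v : 'rV[R]_d -> 'rV[R]_3) : Prop :=
  forall i, in_Vh (fun x => v x 0 i).

(* 'J acts on row vectors from the right, i.e. it is the transpose of the
   matrix (d_j T_i), and u *m ('J T x)^T is the row form of (nabla T)^T u.
   The polynomial representation is only required in the interior of K, since
   fields of H(curl) have no single value on the faces. *)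
Definition in_Hh (xi : 'rV[R]_d -> 'rV[R]_3) : Prop :=
  [/\ Hcurl Om (fun x => embed (inplane (xi x) : 'rV[R]_d)),
      forall K k, P1_on (Khat°)
        (fun x => (inplane (xi (T K x)) *m ('J (T K) x)^T) 0 k) &
      d = 2%N -> in_Vh (fun x => xi x 0 2%:R)].

(* xi x n = 0 on the boundary, for the traces of xi from inside the elements. *)
Definition in_Hh0 (n : 'rV[R]_d -> 'rV[R]_d) (xi : 'rV[R]_d -> 'rV[R]_3) : Prop :=
  in_Hh xi /\
  forall K i x, boundary_facet K i -> facet_relint i x ->
    cross (xi (T K y)) (embed (n (T K x))) @[y --> within (Khat°) (nbhs x)]
      --> (0 : 'rV[R]_3).

Definition nodal_basis (phi : V -> 'rV[R]_d -> R) : Prop :=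
  [/\ forall i, in_Vh (phi i),
      forall i j, phi i (X j) = (i == j)%:R &
      forall x, closure Om x -> \sum_i phi i x = 1].

Variable phi : V -> 'rV[R]_d -> R.

Definition mass (i : V) : R := \int[lebesgue_rV R d]_(x in Om) phi i x.

Definition lump (v w : 'rV[R]_d -> 'rV[R]_3) : R :=
  \sum_i mass i * dot (v (X i)) (w (X i)).

Definition lump_weighted (rho : 'rV[R]_d -> R) (v w : 'rV[R]_d -> 'rV[R]_3) : R :=
  \sum_i mass i * rho (X i) * dot (v (X i)) (w (X i)).

(* The lumped products control the L^2 norm on V_h^3. *)
Definition lump_equiv (cm cM : R) : Prop :=
  forall v, in_Vh3 v ->
    cm * L2norm Om v <= Num.sqrt (lump v v) <= cM * L2norm Om v.

(* Minima: the nodes are finitely many, and functions of V_h are continuous on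
   the compact set closure Om. *)
Definition nodal_min (rho : 'rV[R]_d -> R) : R := inf (range (rho \o X)).

Definition domain_min (r : 'rV[R]_d -> R) : R := inf (r @` closure Om).

Definition jacobian_form (mu di tau : R) (rho r : 'rV[R]_d -> R)
    (vn Hn vk Hk dv dH w xi : 'rV[R]_d -> 'rV[R]_3) : R :=
  let pair := ip Om in
  let cu := curl Om in
  let vp := fun (a b : 'rV[R]_d -> 'rV[R]_3) x => cross (a x) (b x) in
  let rhoV := fun (a : 'rV[R]_d -> 'rV[R]_3) x => (rho x)^-1 *: a x in
    lump_weighted rho dv w + mu * pair dH xi
  - 4^-1 * tau * mu * pair (vp (cu dH) Hn) w
  - 4^-1 * tau * mu * pair (vp (cu Hk) dH) w
  - 4^-1 * tau * mu * pair (vp (cu dH) Hk) w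
  - 4^-1 * tau * mu * pair (vp (cu Hn) dH) w
  + 4^-1 * tau * mu * pair (vp (cu xi) Hn) dv
  + 4^-1 * tau * mu * pair (vp (cu xi) dH) vn
  + 4^-1 * tau * mu * pair (vp (cu xi) Hk) dv
  + 4^-1 * tau * mu * pair (vp (cu xi) dH) vk
  + 2^-1 * tau * pair (fun x => r x *: cu dH x) (cu xi)
  + 4^-1 * mu * di * tau * pair (rhoV (vp (cu Hn) dH)) (cu xi)
  + 4^-1 * mu * di * tau * pair (rhoV (vp (cu dH) Hn)) (cu xi)
  + 4^-1 * mu * di * tau * pair (rhoV (vp (cu Hk) dH)) (cu xi)
  + 4^-1 * mu * di * tau * pair (rhoV (vp (cu dH) Hk)) (cu xi).

End finite_elements.

(* Main.v *)
Require Import Defs.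
From HB Require Import structures.
From mathcomp Require Import all_boot all_order all_algebra.
From mathcomp Require Import all_classical all_reals all_analysis.
From mathcomp Require Import measurable_realfun ess_sup_inf.
From mathcomp Require Import ring lra.

Set Implicit Arguments.
Unset Strict Implicit.
Unset Printing Implicit Defensive.

Import Order.TTheory GRing.Theory Num.Theory.
Import numFieldNormedType.Exports.

Local Open Scope classical_set_scope.
Local Open Scope ring_scope.

(** On the diagonal the Jacobian loses all its dangerous terms. The terms that
    couple [curl dH x H] with [dv], for [H = Hn] or [Hk], occur twice with
    opposite signs and cancel; the Hall terms [curl dH x H] tested with
    [curl dH] vanish pointwise ([ip_cross_self]). For each of the two states
    two indefinite contributions remain.

    - The Lorentz term [(curl H x dH, dv)] is at most
      [c_h / 2 * (|dv|^2 + |dH|^2)] by Young's inequality ([ip_cross_le]).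
    - The remaining Hall term and the induction term [(curl dH x dH, v)] combine
      into [((d_i / rho * curl H - v) x dH, curl dH)], the same triple product
      with the electron velocity as coefficient ([ip_electron_velocity]).
      Only the bound [c_e] on this velocity enters the estimate. Young's
      inequality with weight [tau^(-1/2)] on [|dH|^2] splits the product between
      the mass term of [dH] and the resistive term ([ip_cross_young]).

    The positive terms are bounded below by [lump_weighted_ge], where the lumped
    masses must be known to be nonnegative, and by [ip_scale_ge].

    Linearity of the integral requires all these products to be integrable. Each
    is a product of two square integrable fields with an essentially bounded
    one, so the proof keeps track of these two classes. Membership rests on the
    fact that a finite element function is, on each element, a convex
    combination of its nodal values ([P1_on_barycentric]): it is bounded, and it
    stays above its smallest nodal value, which bounds [1 / rho] and makes the
    nodal basis functions nonnegative. The representative [curl] is square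
    integrable even when it is the default field ([curl_sq_field]). *)

(** * Triple products in three dimensions *)

Section vector_algebra.
Context {R : realType}.
Implicit Types u v w : 'rV[R]_3.

Lemma ord3_cases (i : 'I_3) : [\/ i = 0, i = 1 | i = 2%:R].
Proof.
case: i => -[|[|[|//]]] hi; [apply: Or31|apply: Or32|apply: Or33];
  exact: val_inj.
Qed.

Lemma dot3 u v : dot u v = u 0 0 * v 0 0 + u 0 1 * v 0 1 + u 0 2%:R * v 0 2%:R.
Proof.
rewrite /dot !big_ord_recl big_ord0 addr0 addrA.
by congr (_ * _ + _ * _ + _ * _); congr (_ 0 _); apply: val_inj.
Qed.

Lemma crossE u v :
  (cross u v 0 0 = u 0 1 * v 0 2%:R - u 0 2%:R * v 0 1) *
  (cross u v 0 1 = u 0 2%:R * v 0 0 - u 0 0 * v 0 2%:R) *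
  (cross u v 0 2%:R = u 0 0 * v 0 1 - u 0 1 * v 0 0).
Proof. by rewrite !mxE. Qed.

Lemma dot_ge0 n (u : 'rV[R]_n) : 0 <= dot u u.
Proof. by apply: sumr_ge0 => i _; rewrite -expr2 sqr_ge0. Qed.

Lemma dotZl n (a : R) (u v : 'rV[R]_n) : dot (a *: u) v = a * dot u v.
Proof. by rewrite /dot mulr_sumr; apply: eq_bigr => i _; rewrite mxE mulrA. Qed.

Lemma enorm_sqr n (u : 'rV[R]_n) : enorm u ^+ 2 = dot u u.
Proof. by rewrite sqr_sqrtr ?dot_ge0. Qed.

Lemma coord_le_enorm n (u : 'rV[R]_n) i : `|u 0 i| <= enorm u.
Proof.
rewrite -sqrtr_sqr ler_sqrt ?dot_ge0// /dot (bigD1 i)//= -expr2 lerDl.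
by apply: sumr_ge0 => j _; rewrite -expr2 sqr_ge0.
Qed.

Lemma dot_cross_cycle u v w : dot (cross u v) w = dot (cross w u) v.
Proof. by rewrite !dot3 !crossE; ring. Qed.

Lemma dot_cross_self u v : dot (cross u v) u = 0.
Proof. by rewrite !dot3 !crossE; ring. Qed.

Lemma lagrange_identity u v :
  dot (cross u v) (cross u v) + dot u v ^+ 2 = dot u u * dot v v.
Proof. by rewrite !dot3 !crossE; ring. Qed.

(** The triple product is bounded by the product of the three norms:
    Cauchy-Schwarz twice, each time as a consequence of Lagrange's identity. *)
Lemma dot_cross_sqr u v w :
  dot (cross u v) w ^+ 2 <= dot u u * dot v v * dot w w.
Proof.
apply: (@le_trans _ _ (dot (cross u v) (cross u v) * dot w w)).
  by rewrite -lagrange_identity lerDr dot_ge0.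
by rewrite ler_wpM2r ?dot_ge0// -lagrange_identity lerDl sqr_ge0.
Qed.

(** The weight [s] distributes the triple product between the last two factors. *)
Lemma dot_cross_young {u v w} {K s : R} : enorm u <= K -> 0 < s ->
  - (2^-1 * K * (s * dot v v + s^-1 * dot w w)) <= dot (cross u v) w.
Proof.
move=> uK s0.
have u0 : 0 <= enorm u := sqrtr_ge0 _.
have K0 := le_trans u0 uK.
have := dot_cross_sqr u v w; rewrite -enorm_sqr.
have := dot_ge0 v; have := dot_ge0 w.
set t := dot (cross u v) w; set p := dot v v; set q := dot w w => q0 p0 tpq.
have A0 : 0 <= s * p by rewrite mulr_ge0// ltW.
have B0 : 0 <= s^-1 * q by rewrite mulr_ge0// invr_ge0 ltW.
set c := 2^-1 * K * (s * p + s^-1 * q).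
have c0 : 0 <= c by rewrite !mulr_ge0 ?invr_ge0 ?addr_ge0.
apply: lerNnormlW; rewrite -(ler_pXn2r (ltn0Sn 1))// ?nnegrE//.
rewrite real_normK ?num_real//.
apply: (le_trans tpq); apply: (@le_trans _ _ (K ^+ 2 * (p * q))).
  by rewrite -mulrA ler_wpM2r ?mulr_ge0// ler_sqr ?nnegrE.
have -> : p * q = (s * p) * (s^-1 * q).
  by rewrite mulrACA divff ?mul1r ?gt_eqF.
(* [4 a b <= (a + b) ^ 2] with [a = s p] and [b = q / s]. *)
rewrite /c; move: (s * p) (s^-1 * q) => a b.
rewrite -subr_ge0 (_ : _ - _ = (2^-1 * K * (a - b)) ^+ 2) ?sqr_ge0//.
by field.
Qed.

End vector_algebra.

(** * Square integrable and essentially bounded functions *)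

Section square_integrable.
Context {R : realType} {disp : measure_display} {T : measurableType disp}.
Variables (mu : {measure set T -> \bar R}) (D : set T).
Hypothesis mD : measurable D.
Implicit Types (f g b : T -> R) (u v w : T -> 'rV[R]_3).

Lemma ae_le_integrable {f g} : measurable_fun D f ->
  {ae mu, forall x, D x -> `|f x| <= g x} ->
  mu.-integrable D (EFin \o g) -> mu.-integrable D (EFin \o f).
Proof.
move=> mf fg /integrableP[mg goo]; apply/integrableP; split.
  exact/measurable_EFinP.
apply: le_lt_trans goo; apply: ae_ge0_le_integral => //=.
- by apply/measurable_EFinP; exact: measurableT_comp.
- apply/measurable_EFinP; apply: measurableT_comp => //.
  exact/measurable_EFinP.
- apply: filterS fg => x fg Dx; rewrite lee_fin.
  exact: le_trans (fg Dx) (ler_norm _).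
Qed.

Lemma ae_ge0_Rintegral {f} : measurable_fun D f ->
  {ae mu, forall x, D x -> 0 <= f x} -> 0 <= \int[mu]_(x in D) f x.
Proof.
move=> mf f0; rewrite /Rintegral.
rewrite (@ae_eq_integral _ _ _ mu D (fun x => (`|f x|)%:E))//.
- by apply: fine_ge0; apply: integral_ge0 => x _; rewrite lee_fin.
- exact/measurable_EFinP.
- by apply/measurable_EFinP; exact: measurableT_comp.
- by apply: filterS f0 => x f0 Dx; rewrite ger0_norm ?f0.
Qed.

Lemma ae_le_Rintegral {f g} :
  mu.-integrable D (EFin \o f) -> mu.-integrable D (EFin \o g) ->
  {ae mu, forall x, D x -> f x <= g x} ->
  \int[mu]_(x in D) f x <= \int[mu]_(x in D) g x.
Proof.
move=> fi gi fg; rewrite -subr_ge0 -RintegralB//; apply: ae_ge0_Rintegral.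
  case/integrableP: fi => /measurable_EFinP mf _.
  case/integrableP: gi => /measurable_EFinP mg _.
  exact: measurable_funB.
by apply: filterS fg => x fg /fg; rewrite subr_ge0.
Qed.

Definition ess_bounded f : Prop := measurable_fun D f /\
  exists M : R, {ae mu, forall x, D x -> `|f x| <= M}.

Definition sq_integrable f : Prop := measurable_fun D f /\
  mu.-integrable D (EFin \o (fun x => f x ^+ 2)).

Lemma sq_integrableM f g : sq_integrable f -> sq_integrable g ->
  mu.-integrable D (EFin \o (fun x => f x * g x)).
Proof.
move=> [mf fi] [mg gi].
apply: (@ae_le_integrable _ (fun x => f x ^+ 2 + g x ^+ 2)).
- exact: measurable_funM.
- apply: aeW => x _; rewrite ler_norml; apply/andP; split; nra.
- exact: (integrableD mD fi gi).
Qed.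

Lemma sq_integrableB f g : sq_integrable f -> sq_integrable g ->
  sq_integrable (fun x => f x - g x).
Proof.
move=> [mf fi] [mg gi].
have mfg : measurable_fun D (fun x => f x - g x) by exact: measurable_funB.
split=> //; apply: (@ae_le_integrable _ (fun x => 2 * (f x ^+ 2 + g x ^+ 2))).
- exact: measurable_funX.
- apply: aeW => x _; rewrite ger0_norm ?sqr_ge0// -subr_ge0.
  by rewrite [leRHS](_ : _ = (f x + g x) ^+ 2) ?sqr_ge0//; ring.
- exact: (integrableZl mD 2 (integrableD mD fi gi)).
Qed.

Lemma sq_integrable_bM b f : ess_bounded b -> sq_integrable f ->
  sq_integrable (fun x => b x * f x).
Proof.
move=> [mb [M bM]] [mf fi].
have mbf : measurable_fun D (fun x => b x * f x) by exact: measurable_funM.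
split=> //; apply: (@ae_le_integrable _ (fun x => M ^+ 2 * f x ^+ 2)).
- exact: measurable_funX.
- apply: filterS bM => x bM Dx; rewrite ger0_norm ?sqr_ge0// exprMn.
  rewrite ler_wpM2r ?sqr_ge0// -(real_normK (num_real (b x))).
  by rewrite lerXn2r ?nnegrE ?(le_trans _ (bM Dx)) ?bM.
- exact: (integrableZl mD (M ^+ 2) fi).
Qed.

Lemma bounded_sq_integrable f : (mu D < +oo)%E -> ess_bounded f ->
  sq_integrable f.
Proof.
move=> muD [mf [M fM]]; split=> //.
apply: (@ae_le_integrable _ (fun=> M ^+ 2)).
- exact: measurable_funX.
- apply: filterS fM => x fM Dx; rewrite ger0_norm ?sqr_ge0//.
  rewrite -(real_normK (num_real (f x))).
  by rewrite lerXn2r ?nnegrE ?(le_trans _ (fM Dx)) ?fM.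
- apply/integrableP; split; first exact/measurable_EFinP.
  under eq_integral do rewrite /= ger0_norm ?sqr_ge0//.
  by rewrite integral_cst// lte_mul_pinfty// lee_fin sqr_ge0.
Qed.

Lemma dot_integrable u v : (forall i, sq_integrable (fun x => u x 0 i)) ->
  (forall i, sq_integrable (fun x => v x 0 i)) ->
  mu.-integrable D (EFin \o (fun x => dot (u x) (v x))).
Proof.
move=> ui vi.
rewrite (_ : _ \o _ = fun x => (\sum_(i < 3) (u x 0 i * v x 0 i)%:E)%E).
  by apply: integrable_sum => // i _; exact: sq_integrableM.
by apply/funext => x /=; rewrite sumEFin.
Qed.

Lemma cross_sq_integrable (b u : T -> 'rV[R]_3) :
  (forall i, ess_bounded (fun x => b x 0 i)) ->
  (forall i, sq_integrable (fun x => u x 0 i)) ->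
  forall i, sq_integrable (fun x => cross (b x) (u x) 0 i).
Proof.
move=> bb ui i; case: (ord3_cases i) => ->; under eq_fun do rewrite crossE;
  by apply: sq_integrableB; exact: sq_integrable_bM.
Qed.

(** The coefficient [b] is only bounded almost everywhere, hence the comparison
    of integrals through [ae_le_Rintegral]. *)
Lemma Rintegral_cross_young (b u v : T -> 'rV[R]_3) (K s : R) :
  (forall i, ess_bounded (fun x => b x 0 i)) ->
  {ae mu, forall x, D x -> enorm (b x) <= K} ->
  (forall i, sq_integrable (fun x => u x 0 i)) ->
  (forall i, sq_integrable (fun x => v x 0 i)) -> 0 < s ->
  - (2^-1 * K * (s * \int[mu]_(x in D) dot (u x) (u x) +
                 s^-1 * \int[mu]_(x in D) dot (v x) (v x)))
  <= \int[mu]_(x in D) dot (cross (b x) (u x)) (v x).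
Proof.
move=> bb bK ui vi s0.
have uu := dot_integrable ui ui; have vv := dot_integrable vi vi.
have buv := dot_integrable (cross_sq_integrable bb ui) vi.
have su := integrableZl mD s uu; have sv := integrableZl mD s^-1 vv.
rewrite -!RintegralZl// -RintegralD// -mulNr -RintegralZl//; last first.
  exact: (integrableD mD su sv).
apply: ae_le_Rintegral => //.
  exact: (integrableZl mD _ (integrableD mD su sv)).
apply: filterS bK => x bK Dx; rewrite mulNr.
exact: dot_cross_young (bK Dx) s0.
Qed.

End square_integrable.

(** * Borel sets of row vectors *)

Section borel_rV.
Context {R : realType} {n : nat}.

Lemma measurable_box (I : 'I_n -> interval R) :
  measurable [set y : 'rV[R]_n | forall i, y 0 i \in I i].
Proof.
rewrite (_ : [set y | _] = \bigcap_(i in [set: 'I_n])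
   ((fun y : 'rV_n => y ord0 i) @^-1` [set` I i])).
  apply: fin_bigcap_measurable => [|i _]; first exact: finite_finset.
  rewrite -[X in measurable X]setTI.
  exact: (measurable_coord i measurableT (measurable_itv _)).
by apply/seteqP; split => y /= H i; [move=> _; exact: H|exact: H].
Qed.

Definition rat_box (q : 'rV[rat]_n * 'rV[rat]_n) : set 'rV[R]_n :=
  [set y | forall i, y 0 i \in `]ratr (q.1 0 i), ratr (q.2 0 i)[].

(** The sigma-algebra is the one generated by the coordinates; an open set
    belongs to it because it is a countable union of boxes with rational
    corners. *)
Lemma open_measurable_rV (U : set 'rV[R]_n) : open U -> measurable U.
Proof.
move=> oU.
rewrite (_ : U = \bigcup_q (if `[< rat_box q `<=` U >] then rat_box q else set0)).
  apply: countable_bigcupT_measurable => [|q]; first exact: countableP.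
  by case: ifP => _; [exact: measurable_box|exact: measurable0].
apply/seteqP; split => [x Ux|x [q _]]; last by case: asboolP => // qU /qU.
have /nbhs_ballP[e /= e0 eU] := open_nbhs_nbhs (conj oU Ux).
have [a ha] := choice (fun i : 'I_n =>
  @rat_in_itvoo R (x 0 i - e) (x 0 i) (ltac:(by rewrite ltrBlDr ltrDl))).
have [b hb] := choice (fun i : 'I_n =>
  @rat_in_itvoo R (x 0 i) (x 0 i + e) (ltac:(by rewrite ltrDl))).
exists (\row_i a i, \row_i b i) => //.
case: asboolP => [_ i|[]].
  by rewrite in_itv /= !mxE (itvP (ha i)) (itvP (hb i)).
move=> y yab; apply: eU; split=> // i j; rewrite (ord1 i) /ball /=.
have := yab j; rewrite in_itv /= !mxE => /andP[aj bj].
have := itvP (ha j); have := itvP (hb j) => hbj haj.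
rewrite ltr_norml; apply/andP; split.
  by rewrite ltrNl opprB ltrBlDr addrC (lt_trans bj)// hbj.
by rewrite ltrBlDr -ltrBlDl (le_lt_trans _ aj)// haj.
Qed.

Lemma continuous_measurable_fun_rV (D : set 'rV[R]_n) (f : 'rV[R]_n -> R) :
  open D -> {in D, continuous f} -> measurable_fun D f.
Proof.
move=> oD; rewrite -(continuous_open_subspace f oD) => /continuousP cf.
apply: (measurability _ (RGenOpens.measurableE R)).
move=> _ [_ [a [b ->] <-]]; apply: open_measurable_rV.
by rewrite open_setSI//; exact/cf/interval_open.
Qed.

Lemma bounded_lebesgue_rV (D : set 'rV[R]_n) : measurable D -> bounded_set D ->
  (lebesgue_rV R n D < +oo)%E.
Proof.
move=> mD [M [Mreal DM]].
pose N := `|M| + 1.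
have N0 : 0 <= N by rewrite addr_ge0.
have /(_ _)DN : forall x, D x -> `|x| <= N.
  by apply: DM; rewrite (le_lt_trans (ler_norm _))// ltrDl.
apply: (@le_lt_trans _ _ (lebesgue_rV R n
  [set x | forall i, (\row_(_ < n) - N) ord0 i <= x ord0 i
                     <= (\row_(_ < n) N) ord0 i])).
  apply: le_measure; rewrite ?inE//.
    rewrite (_ : [set x | _] = [set x | forall i, x 0 i \in `[- N, N]]).
      exact: measurable_box.
    by apply/seteqP; split=> x Nx i; have := Nx i; rewrite !mxE in_itv.
  move=> x Dx i; rewrite !mxE -ler_norml (le_trans _ (DN x Dx))//.
  rewrite [leRHS]mx_normrE; exact: (le_bigmax _ _ (ord0, i)).
rewrite lebesgue_rV_box ?ltry// => i; rewrite !mxE.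
by rewrite (le_trans _ N0)// oppr_le0.
Qed.

End borel_rV.

(** * Finite element functions are controlled by their nodal values *)

Section finite_element_functions.
Context {R : realType} {d : nat}.

(** Both sides are affine in [x] and agree at the vertices; expanding the
    barycentric coordinates proves it directly. *)
Lemma P1_on_barycentric (f : 'rV[R]_d -> R) : P1_on Khat f ->
  forall x, Khat x -> f x = \sum_i bary i x * f (vtx i).
Proof.
move=> [a [b fE]] x xK.
have vK i : Khat (vtx i : 'rV[R]_d).
  move=> j; rewrite /bary; case: unliftP => [k _|_] /=.
    by rewrite mxE ler0n.
  rewrite subr_ge0; case: (unliftP ord0 i) => [k ->|->].
    rewrite (bigD1 k)//= mxE eqxx big1 ?addr0// => j' /negbTE jk.
    by rewrite mxE (inj_eq lift_inj) eq_sym jk.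
  by rewrite big1// => k _; rewrite mxE (negbTE (neq_lift _ _)).
rewrite big_ord_recl fE// /bary unlift_none /=.
rewrite [X in _ = _ + X](eq_bigr (fun k => x 0 k * (a + b 0 k))).
  rewrite fE// (_ : dot b (vtx ord0) = 0); last first.
    by rewrite /dot big1// => k _; rewrite mxE (negbTE (neq_lift _ _)) mulr0.
  under [X in _ = _ + X]eq_bigr do rewrite mulrDr.
  rewrite big_split /= -mulr_suml addr0 mulrBl mul1r addrA subrK.
  by congr (_ + _); apply: eq_bigr => k _; rewrite mulrC.
move=> k _; rewrite liftK fE//=; congr (_ * (_ + _)).
rewrite /dot (bigD1 k)//= mxE eqxx mulr1 big1 ?addr0// => j /negbTE jk.
by rewrite mxE (inj_eq lift_inj) eq_sym jk mulr0.
Qed.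

Lemma bary_sum (x : 'rV[R]_d) : \sum_i bary i x = 1.
Proof.
rewrite big_ord_recl /bary unlift_none /= -[RHS](subrK (\sum_k x 0 k)).
by congr (_ + _); apply: eq_bigr => k _; rewrite liftK.
Qed.

Context {Om : set 'rV[R]_d} {E V : finType}.
Context {T : E -> 'rV[R]_d -> 'rV[R]_d} {X : V -> 'rV[R]_d}.
Hypothesis mesh : simplicial_mesh Om T X.

(** The images of the vertices of the unit simplex are mesh nodes, and the
    barycentric coordinates are nonnegative weights of sum 1. *)
Lemma in_Vh_ge v c : in_Vh Om T v -> (forall j, c <= v (X j)) ->
  forall x, closure Om x -> c <= v x.
Proof.
move=> [_ vP1] cv x; case: mesh => _ <- _ _ rX [K _ [y yK <-]].
rewrite -[v _]/((v \o T K) y) (P1_on_barycentric (vP1 K) yK).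
rewrite -[c]mul1r -(bary_sum y) mulr_suml; apply: ler_sum => i _.
apply: ler_wpM2l; first exact: yK.
have [j _ /= <-] : range X (T K (vtx i)) by rewrite rX; exists K, i.
exact: cv.
Qed.

Lemma in_VhN v : in_Vh Om T v -> in_Vh Om T (fun x => - v x).
Proof.
move=> [cv Pv]; split; first by move=> x; apply: cvgN; exact: cv.
move=> K; have [a [b vE]] := Pv K; exists (- a), (- b) => x xK.
rewrite /= -[v _]/((v \o T K) x) vE// opprD; congr (_ + _).
by rewrite /dot -sumrN; apply: eq_bigr => i _; rewrite mxE mulNr.
Qed.

Lemma in_Vh_bounded v : in_Vh Om T v ->
  exists M, forall x, closure Om x -> `|v x| <= M.
Proof.
move=> vV; exists (\sum_j `|v (X j)|) => x Ox.
have le j : `|v (X j)| <= \sum_j `|v (X j)|.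
  by rewrite (bigD1 j)//= lerDl sumr_ge0.
rewrite ler_norml; apply/andP; split.
  apply: in_Vh_ge Ox => // j.
  by rewrite lerNl (le_trans _ (le j))// -normrN ler_norm.
rewrite -lerN2; apply: (in_Vh_ge (in_VhN vV)) Ox => j.
by rewrite lerN2 (le_trans _ (le j))// ler_norm.
Qed.

(** The least nodal value is positive since there are finitely many nodes; the
    base value 1 of the minimum covers an empty set of nodes. *)
Lemma in_Vh_gt0 v : in_Vh Om T v -> (forall j, 0 < v (X j)) ->
  exists2 c, 0 < c & forall x, closure Om x -> c <= v x.
Proof.
move=> vV v0; exists (\big[Num.min/1]_j v (X j)).
  by apply: lt_bigmin.
by apply: in_Vh_ge => // j; exact: bigmin_le_cond.
Qed.

Lemma mass_ge0 (phi : V -> 'rV[R]_d -> R) : nodal_basis Om T X phi ->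
  forall i, 0 <= mass Om phi i.
Proof.
move=> [phiV phiX _] i; apply: Rintegral_ge0 => x /subset_closure Ox.
by apply: in_Vh_ge Ox => // j; rewrite phiX ler0n.
Qed.

Hypothesis oOm : open Om.

Lemma in_Vh_continuous v : in_Vh Om T v -> {in Om, continuous v}.
Proof.
move=> [cv _]; rewrite -(continuous_open_subspace _ oOm).
exact: continuous_subspaceW (@subset_closure _ Om) cv.
Qed.

Lemma in_Vh_ess_bounded v : in_Vh Om T v -> ess_bounded (lebesgue_rV R d) Om v.
Proof.
move=> vV; split.
  exact: continuous_measurable_fun_rV oOm (in_Vh_continuous vV).
have [M vM] := in_Vh_bounded vV; exists M.
by apply: aeW => x /subset_closure; exact: vM.
Qed.

Lemma in_Vh_inv_ess_bounded v : in_Vh Om T v -> (forall j, 0 < v (X j)) ->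
  ess_bounded (lebesgue_rV R d) Om (fun x => (v x)^-1).
Proof.
move=> vV v0; have [c c0 cv] := in_Vh_gt0 vV v0; split.
  apply: continuous_measurable_fun_rV => // x xOm.
  apply: (cvgV _ (in_Vh_continuous vV xOm)).
  rewrite gt_eqF// (lt_le_trans c0)// cv//.
  by apply: subset_closure; exact: set_mem.
exists c^-1; apply: aeW => x /subset_closure /cv cvx.
rewrite ger0_norm ?invr_ge0 ?(le_trans (ltW c0))//.
by rewrite lef_pV2 ?posrE// (lt_le_trans c0).
Qed.

End finite_element_functions.

(** * Bounds for the bilinear terms *)

Section field_spaces.
Context {R : realType} {d : nat} {Om : set 'rV[R]_d}.
Hypothesis mOm : measurable Om.
Implicit Types u v w b : 'rV[R]_d -> 'rV[R]_3.

Definition sq_field u : Prop :=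
  forall i, sq_integrable (lebesgue_rV R d) Om (fun x => u x 0 i).

Definition ess_field u : Prop :=
  forall i, ess_bounded (lebesgue_rV R d) Om (fun x => u x 0 i).

Lemma L2_sq_field u : L2 Om u -> sq_field u.
Proof.
move=> uL2 i; have := uL2 i => /[dup] /Lfun2_integrable_sqr iu.
rewrite inE => /andP[]; rewrite inE => mu _; split.
  exact/(measurable_restrictT _ mOm).
rewrite -[X in integrable _ X _]setTI.
apply/(integrable_restrict (lebesgue_rV R d) _ measurableT); first exact: mOm.
rewrite (_ : patch _ _ _ =
  EFin \o (fun x => ((fun x => u x 0 i) \_ Om) x ^+ 2))//.
apply/funext => x; rewrite /= !patchE.
by case: ifP => //; rewrite expr0n.
Qed.

(** A field without a weak curl has [curl] equal to [0], which is also square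
    integrable. *)
Lemma curl_sq_field u : sq_field (curl Om u).
Proof.
rewrite /curl; case: xgetP => [om _ [omL2 _]|_]; first exact: L2_sq_field.
move=> i; split; first by under eq_fun do rewrite mxE; exact: measurable_cst.
rewrite (_ : _ \o _ = cst 0%E); first exact: integrable0.
by apply/funext => x /=; rewrite mxE expr0n.
Qed.

Lemma Linfnorm_le u (c : R) : (Linfnorm Om u <= c%:E)%E ->
  {ae lebesgue_rV R d, forall x, Om x -> enorm (u x) <= c}.
Proof.
rewrite /Linfnorm unlock; case: ifPn => [_ /ess_supP|].
  apply: filterS => x; rewrite /= patchE => + Omx.
  by rewrite mem_set// lee_fin ger0_norm ?sqrtr_ge0.
(* The norm is 0 by convention on a space of measure 0, where every property
   holds almost everywhere. *)
rewrite -leNgt => m0 _; exists setT; split=> //.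
by apply/eqP; rewrite eq_le m0/=.
Qed.

Lemma ess_field_enorm u (c : R) :
  (forall i, measurable_fun Om (fun x => u x 0 i)) ->
  {ae lebesgue_rV R d, forall x, Om x -> enorm (u x) <= c} -> ess_field u.
Proof.
move=> mu uc i; split=> //; exists c; apply: filterS uc => x uc /uc.
exact/le_trans/coord_le_enorm.
Qed.

Lemma L2norm_sqr u : L2norm Om u ^+ 2 = ip Om u u.
Proof. by rewrite sqr_sqrtr// Rintegral_ge0// => x _; exact: dot_ge0. Qed.

Lemma sq_field_scale (f : 'rV[R]_d -> R) u :
  ess_bounded (lebesgue_rV R d) Om f -> sq_field u ->
  sq_field (fun x => f x *: u x).
Proof.
by move=> fb us i; under eq_fun do rewrite mxE; exact: sq_integrable_bM.
Qed.

(** A Hall term whose current is the test function itself does no work. *)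
Lemma ip_cross_self (f : 'rV[R]_d -> R) u v :
  ip Om (fun x => f x *: cross (u x) (v x)) u = 0.
Proof.
rewrite /ip (@eq_Rintegral _ _ _ _ Om (fun=> 0)); last first.
  by move=> x _; rewrite dotZl dot_cross_self mulr0.
by rewrite Rintegral_cst// mul0r.
Qed.

Lemma ip_cross_young (b u w : 'rV[R]_d -> 'rV[R]_3) (K s : R) :
  ess_field b -> {ae lebesgue_rV R d, forall x, Om x -> enorm (b x) <= K} ->
  sq_field u -> sq_field w -> 0 < s ->
  - (2^-1 * K * (s * ip Om u u + s^-1 * ip Om w w))
  <= ip Om (fun x => cross (b x) (u x)) w.
Proof. by move=> *; exact: Rintegral_cross_young. Qed.

(** Exchanging [u] and [w] changes the sign of the triple product, so the lower
    bound of [ip_cross_young] is also an upper bound. *)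
Lemma ip_cross_le (b u w : 'rV[R]_d -> 'rV[R]_3) (K : R) :
  ess_field b -> {ae lebesgue_rV R d, forall x, Om x -> enorm (b x) <= K} ->
  sq_field u -> sq_field w ->
  ip Om (fun x => cross (b x) (u x)) w
  <= 2^-1 * K * (ip Om w w + ip Om u u).
Proof.
move=> bb bK us ws; rewrite -[leLHS]opprK lerNl.
have -> : - ip Om (fun x => cross (b x) (u x)) w =
  ip Om (fun x => cross (b x) (w x)) u.
  rewrite -mulN1r -RintegralZl//; last first.
    by apply: dot_integrable => //; exact: cross_sq_integrable.
  by apply: eq_Rintegral => x _; rewrite !dot3 !crossE; ring.
have := ip_cross_young bb bK ws us ltr01.
by rewrite invr1 !mul1r.
Qed.

(** By cyclicity the induction term is a triple product with coefficient [- v],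
    which merges with the Hall term. *)
Lemma ip_electron_velocity (f : 'rV[R]_d -> R) (k : R) w v h :
  ess_bounded (lebesgue_rV R d) Om f -> ess_field w -> ess_field v ->
  sq_field h -> forall c, sq_field c ->
  k * ip Om (fun x => f x *: cross (w x) (h x)) c
    + ip Om (fun x => cross (c x) (h x)) v
  = ip Om (fun x => cross (k * f x *: w x - v x) (h x)) c.
Proof.
move=> fb wb vb hs c cs.
have iw : (lebesgue_rV R d).-integrable Om
    (EFin \o (fun x => dot (f x *: cross (w x) (h x)) (c x))).
  apply: dot_integrable => //.
  by apply: sq_field_scale => //; exact: cross_sq_integrable.
have iv : (lebesgue_rV R d).-integrable Om
    (EFin \o (fun x => dot (cross (c x) (h x)) (v x))).
  rewrite (_ : _ \o _ = EFin \o (fun x => dot (cross (v x) (c x)) (h x))).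
    by apply: dot_integrable => //; exact: cross_sq_integrable.
  by apply/funext => x /=; rewrite dot_cross_cycle.
rewrite -RintegralZl// -RintegralD//; last exact: (integrableZl mOm k iw).
by apply: eq_Rintegral => x _; rewrite dotZl !dot3 !crossE !mxE; ring.
Qed.

Lemma ip_scale_ge (f : 'rV[R]_d -> R) (m : R) u :
  ess_bounded (lebesgue_rV R d) Om f -> sq_field u ->
  (forall x, Om x -> m <= f x) ->
  m * ip Om u u <= ip Om (fun x => f x *: u x) u.
Proof.
move=> fb us mf; have iu := dot_integrable mOm us us.
rewrite -RintegralZl//; apply: le_Rintegral => //.
- exact: (integrableZl mOm m iu).
- by apply: dot_integrable => //; exact: sq_field_scale.
- by move=> x Omx; rewrite dotZl ler_wpM2r ?dot_ge0 ?mf.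
Qed.

(** Membership in H(curl) only controls the first [d] components; for [d = 2] the
    third one is a finite element function, bounded on a domain of finite
    measure. *)
Lemma in_Hh_sq_field (E V : finType) (T : E -> 'rV[R]_d -> 'rV[R]_d)
    (X : V -> 'rV[R]_d) (u : 'rV[R]_d -> 'rV[R]_3) :
  d = 2%N \/ d = 3%N -> open Om -> bounded_set Om -> simplicial_mesh Om T X ->
  in_Hh Om T u -> sq_field u.
Proof.
move=> hd oOm bOm mesh [[/L2_sq_field uL2 _] _ uz] i.
have [id|di] := ltnP i d.
  have := uL2 i; under eq_fun do rewrite mxE insubT /= mxE /= inord_val.
  by [].
have d2 : d = 2%N by case: hd => // d3; move: di; rewrite d3 leqNgt ltn_ord.
have -> : i = 2%:R.
  apply: val_inj; apply/eqP; rewrite eqn_leq -ltnS ltn_ord /=.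
  by move: di; rewrite d2.
apply: bounded_sq_integrable => //; first exact: bounded_lebesgue_rV.
by apply: (in_Vh_ess_bounded mesh) => //; exact: uz.
Qed.

End field_spaces.

(** * Coercivity *)

Section coercivity.
Context {R : realType} {d : nat} {Om : set 'rV[R]_d} {E V : finType}.
Context {T : E -> 'rV[R]_d -> 'rV[R]_d} {X : V -> 'rV[R]_d}.
Hypothesis mesh : simplicial_mesh Om T X.

(** With nonnegative masses the density can be replaced by its least nodal value;
    the norm equivalence does the rest. *)
Lemma lump_weighted_ge (phi : V -> 'rV[R]_d -> R) (rho : 'rV[R]_d -> R)
    (cm cM : R) v :
  nodal_basis Om T X phi -> 0 < cm -> lump_equiv Om T X phi cm cM ->
  (forall i, 0 < rho (X i)) -> in_Vh3 Om T v ->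
  cm ^+ 2 * nodal_min X rho * ip Om v v <= lump_weighted Om X phi rho v v.
Proof.
move=> hphi cm0 hcm rho0 vV.
have lb : has_lbound (range (rho \o X)).
  by exists 0 => _ [i _ <-]; exact/ltW/rho0.
have min_le i : nodal_min X rho <= rho (X i) by apply: ge_inf => //; exists i.
have min_ge0 : 0 <= nodal_min X rho.
  rewrite /nodal_min; have [->|/set0P ne] := eqVneq (range (rho \o X)) set0.
    by rewrite inf0.
  by apply: lb_le_inf => // _ [i _ <-]; exact/ltW/rho0.
have mdot i : 0 <= mass Om phi i * dot (v (X i)) (v (X i)).
  by rewrite mulr_ge0 ?dot_ge0// (mass_ge0 mesh hphi).
have lump0 : 0 <= lump Om X phi v v by apply: sumr_ge0.
apply: (@le_trans _ _ (nodal_min X rho * lump Om X phi v v)).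
  rewrite [_ * nodal_min _ _]mulrC -mulrA ler_wpM2l// -(sqr_sqrtr lump0).
  rewrite -L2norm_sqr -exprMn lerXn2r ?nnegrE ?sqrtr_ge0//.
    by rewrite mulr_ge0 ?sqrtr_ge0// ltW.
  by have /andP[] := hcm v vV.
rewrite /lump mulr_sumr; apply: ler_sum => i _.
by rewrite [_ * rho _]mulrC -mulrA ler_wpM2r.
Qed.

Lemma domain_min_le (r : 'rV[R]_d -> R) x :
  (forall x, closure Om x -> 0 < r x) -> closure Om x -> domain_min Om r <= r x.
Proof.
move=> r0 Omx; apply: ge_inf; last by exists x.
by exists 0 => _ [y /r0/ltW ? <-].
Qed.

End coercivity.

Theorem propositionB1 (R : realType) (d : nat) (hd : d = 2%N \/ d = 3%N)
  (* domain, mesh, outward unit normal, nodal basis *)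
  (Om : set 'rV[R]_d) (hOm : bounded_domain Om)
  (E V : finType) (T : E -> 'rV[R]_d -> 'rV[R]_d) (X : V -> 'rV[R]_d)
  (hmesh : simplicial_mesh Om T X)
  (n : 'rV[R]_d -> 'rV[R]_d) (hn : outward_unit_normal Om T n)
  (phi : V -> 'rV[R]_d -> R) (hphi : nodal_basis Om T X phi)
  (* constants *)
  (c_m c_M : R) (hc_m : 0 < c_m) (hc_M : 0 < c_M)
  (hnorm : lump_equiv Om T X phi c_m c_M)
  (mu d_i tau : R) (hmu : 0 < mu) (hd_i : 0 < d_i) (htau : 0 < tau)
  (* density, resistivity, states *)
  (rho r : 'rV[R]_d -> R)
  (hrho : in_Vh Om T rho) (hrho_pos : forall i, 0 < rho (X i))
  (hr : in_Vh Om T r) (hr_pos : forall x, closure Om x -> 0 < r x)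
  (vn vk Hn Hk : 'rV[R]_d -> 'rV[R]_3)
  (hvn : in_Vh3 Om T vn) (hvk : in_Vh3 Om T vk)
  (hHn : in_Hh0 Om T n Hn) (hHk : in_Hh0 Om T n Hk)
  (c_h c_e : R) (hc_h : 0 < c_h) (hc_e : 0 < c_e)
  (hcurl_n : (Linfnorm Om (curl Om Hn) <= c_h%:E)%E)
  (hcurl_k : (Linfnorm Om (curl Om Hk) <= c_h%:E)%E)
  (he_n : (Linfnorm Om (fun x => ((d_i / rho x) *: curl Om Hn x - vn x)%R)
             <= c_e%:E)%E)
  (he_k : (Linfnorm Om (fun x => ((d_i / rho x) *: curl Om Hk x - vk x)%R)
             <= c_e%:E)%E) :
  forall dv dH : 'rV[R]_d -> 'rV[R]_3, in_Vh3 Om T dv -> in_Hh0 Om T n dH ->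
    (c_m ^+ 2 * nodal_min X rho - 4^-1 * tau * mu * c_h) * L2norm Om dv ^+ 2
    + mu * (1 - 4^-1 * (c_h * tau + c_e * Num.sqrt tau)) * L2norm Om dH ^+ 2
    + 2^-1 * tau * (domain_min Om r - 2^-1 * mu * c_e * Num.sqrt tau)
      * L2norm Om (curl Om dH) ^+ 2
    <= jacobian_form Om X phi mu d_i tau rho r vn Hn vk Hk dv dH dv dH.
Proof.
move=> dv dH dvV dHH.
have [oOm _ bOm _] := hOm.
have mOm : measurable Om := open_measurable_rV oOm.
have Vsq v : in_Vh3 Om T v -> sq_field (Om := Om) v.
  move=> vV i; apply: bounded_sq_integrable => //.
    exact: bounded_lebesgue_rV.
  by apply: (in_Vh_ess_bounded hmesh) => //; exact: vV.
have Hsq u : in_Hh0 Om T n u -> sq_field (Om := Om) u.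
  by move=> [uH _]; exact: in_Hh_sq_field hmesh uH.
have dvs := Vsq _ dvV; have dHs := Hsq _ dHH.
pose C := curl Om dH; have Cs : sq_field (Om := Om) C := curl_sq_field mOm dH.
have rho_inv := in_Vh_inv_ess_bounded hmesh oOm hrho hrho_pos.
(* The two estimates that are needed for each of the states n and k. The second
   one is multiplied by tau: the Young weight [tau^(-1/2)] then leaves only
   powers of [sqrt tau], and what remains is linear. *)
have Hall (H v : 'rV[R]_d -> 'rV[R]_3) : in_Vh3 Om T v ->
    (Linfnorm Om (curl Om H) <= c_h%:E)%E ->
    (Linfnorm Om (fun x => ((d_i / rho x) *: curl Om H x - v x)%R) <= c_e%:E)%E ->
    ip Om (fun x => cross (curl Om H x) (dH x)) dv
      <= 2^-1 * c_h * (ip Om dv dv + ip Om dH dH)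
    /\ - (2^-1 * c_e * (Num.sqrt tau * ip Om dH dH
                        + tau * Num.sqrt tau * ip Om C C))
      <= tau * (d_i * ip Om (fun x => (rho x)^-1 *: cross (curl Om H x) (dH x)) C
                + ip Om (fun x => cross (C x) (dH x)) v).
  move=> vV /Linfnorm_le Hh /Linfnorm_le He.
  have mH i := (curl_sq_field mOm H i).1.
  have Hb := ess_field_enorm mH Hh.
  have vb : ess_field (Om := Om) v.
    by move=> i; apply: (in_Vh_ess_bounded hmesh) => //; exact: vV.
  split; first exact: ip_cross_le.
  rewrite ip_electron_velocity//.
  have Eb : ess_field (Om := Om) (fun x => d_i / rho x *: curl Om H x - v x).
    apply: ess_field_enorm He => i; under eq_fun do rewrite !mxE.
    apply: measurable_funB; last exact: (vb i).1.
    apply: measurable_funM; last exact: mH.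
    by apply: measurable_funM => //; exact: rho_inv.1.
  have st0 : 0 < (Num.sqrt tau)^-1 by rewrite invr_gt0 sqrtr_gt0.
  have := ip_cross_young mOm Eb He dHs Cs st0.
  rewrite invrK -(ler_pM2l htau); apply: le_trans.
  rewrite mulrN lerN2 mulrCA mulrDr mulrA [tau * (_ * _)]mulrA.
  have -> // : tau * (Num.sqrt tau)^-1 = Num.sqrt tau.
  by rewrite -{1}(sqr_sqrtr (ltW htau)) expr2 mulfK// gt_eqF ?sqrtr_gt0.
have [chn cen] := Hall _ _ hvn hcurl_n he_n.
have [chk cek] := Hall _ _ hvk hcurl_k he_k.
have lumpge := lump_weighted_ge hmesh hphi hc_m hnorm hrho_pos dvV.
have rge := ip_scale_ge mOm (in_Vh_ess_bounded hmesh oOm hr) Cs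
  (fun x Omx => domain_min_le hr_pos (subset_closure Omx)).
rewrite /jacobian_form !L2norm_sqr -/C !(ip_cross_self mOm).
have tm0 : 0 <= 4^-1 * tau * mu by rewrite !mulr_ge0 ?invr_ge0// ltW.
have m0 : 0 <= 4^-1 * mu by rewrite !mulr_ge0 ?invr_ge0// ltW.
have t0 : 0 <= 2^-1 * tau by rewrite !mulr_ge0 ?invr_ge0// ltW.
move: chn chk => /(ler_wpM2l tm0) chn /(ler_wpM2l tm0) chk.
move: cen cek => /(ler_wpM2l m0) cen /(ler_wpM2l m0) cek.
move: rge => /(ler_wpM2l t0) rge.
move: lumpge chn chk cen cek rge.
(* Only a linear inequality in monomials of the following reals remains. *)
repeat match goal with |- context [ip Om ?u ?w] => move: (ip Om u w) => ? end.
move: (lump_weighted _ _ _ _ _ _) (nodal_min _ _) (domain_min _ _).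
move: (Num.sqrt tau); clear - R c_m c_h c_e mu d_i tau => *.
lra.
Qed.
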